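(* Let $\lambda>0$ and $0<\nu<2$. Let $u_\nu$ be the solution of $\frac{\partial^{\nu}u}{\partial t^{\nu}}=\lambda^2\frac{\partial^2u}{\partial x^2}$, $x\in\mathbb{R}$, $t>0$, with $u(x,0)=\delta(x)$ if $0<\nu\le1$ and $u(x,0)=\delta(x)$, $u_t(x,0)=0$ if $1<\nu<2$. Then \begin{align*} u_\nu(x,t)&=\frac{1}{2\pi\lambda t^{\nu/2}}\int_0^{+\infty}e^{-w}w^{\nu/2-1}e^{-\frac{|x|w^{\nu/2}}{\lambda t^{\nu/2}}\cos\frac{\nu\pi}{2}}\sin\!\left(\frac{\nu\pi}{2}-\frac{|x|w^{\nu/2}}{\lambda t^{\nu/2}}\sin\frac{\nu\pi}{2}\right)dw\\ &=\frac{1}{\nu\pi}\int_0^{+\infty}e^{-|x|y\cos\frac{\nu\pi}{2}-(\lambda y)^{2/\nu}t}\sin\!\left(\frac{\nu\pi}{2}-|x|y\sin\frac{\nu\pi}{2}\right)dy. \end{align*}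
   Context: Fractional derivatives are in the Dzherbashyan–Caputo sense: for $m-1<\nu<m$, $\frac{\partial^{\nu}u}{\partial t^{\nu}}(x,t)=\frac{1}{\Gamma(m-\nu)}\int_0^t (t-s)^{m-\nu-1}\frac{\partial^m u}{\partial s^m}(x,s)\,ds$; for $\nu=m$ the ordinary derivative. The solution is $u_\nu(x,t)=\frac{1}{2\lambda t^{\nu/2}}\sum_{k\ge0}\frac{(-|x|/(\lambda t^{\nu/2}))^k}{k!\,\Gamma(-\nu k/2+1-\nu/2)}$. *)

(* Defs.v *)
From Stdlib Require Import Reals Lra Factorial.
From Coquelicot Require Import Coquelicot.
Open Scope R_scope.

Fixpoint rising_prod (z : R) (n : nat) : R :=
  match n with
  | O => z
  | S m => rising_prod z m * (z + INR (S m))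
  end.

(* Reciprocal Gamma function 1/Gamma(z), entire, equal to 0 at the poles
   z = 0, -1, -2, ...  Defined by Gauss' limit formula
   1/Gamma(z) = lim_n z (z+1) ... (z+n) / (n! n^z). *)
Definition rgamma (z : R) : R :=
  real (Lim_seq (fun n => rising_prod z n / (INR (fact n) * Rpower (INR n) z))).

Definition u_nu (lambda nu x t : R) : R :=
  / (2 * lambda * Rpower t (nu / 2)) *
  Series (fun k : nat =>
    (- Rabs x / (lambda * Rpower t (nu / 2))) ^ k / INR (fact k)
    * rgamma (- nu * INR k / 2 + 1 - nu / 2)).

(* Main.v *)
Require Import Defs.
From Stdlib Require Import Reals Factorial Lra Lia.
From Coquelicot Require Import Coquelicot.
Open Scope R_scope.

(** Put [a = nu/2], [theta = a PI] and [z = |x| / (lambda t^a)].  The function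
    [e^(-u cos theta) sin (theta - u sin theta)] is the imaginary part of
    [e^(i theta) exp (-u e^(i theta))], so its Taylor coefficients are
    [(-1)^k sin ((k+1) theta) / k!].  At [u = z w^a], integration against
    [e^-w w^(a-1)] turns the [k]-th term into
    [(-z)^k/k! sin (PI a (k+1)) Gamma (a (k+1)) = PI (-z)^k/k! / Gamma (1 - a (k+1))]
    by the reflection formula.  Sum and integral may be exchanged because the [n]-th
    Taylor remainder is at most [2^-(n+1) e^(3u)], and [e^(3 z w^a) e^-w w^(a-1)] is
    integrable since [a < 1].  The substitution [w = (lambda y)^(2/nu) t] gives the
    second integral.

    The reflection formula is obtained for the Gauss quotients: those of [s] and [1 - s]
    multiply to a partial product of Euler's sine product, and those of [s] tend to
    [1 / Gamma s] by Wendel's inequality [Gamma (p + s) <= p^s Gamma p], [0 <= s <= 1].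
    The sine product follows from [I s n = int_0^(PI/2) cos (2 s t) cos^(2n) t dt]:
    integrating by parts twice relates [I s (n+1)] to [I s n] by the factor
    [1 - s^2/(n+1)^2], up to a factor independent of [s], and [I s n / I 0 n] tends to 1. *)

(** * Improper integrals over the open half-line *)

Definition improper (f : R -> R) (l : R) : Prop :=
  is_RInt_gen f (at_right 0) (Rbar_locally p_infty) l.

(** The kernels [w^(s-1)] with [s < 1] blow up at 0, and [Rpower] takes only conventional values at
    [w <= 0]. *)
Definition continuous_pos (f : R -> R) : Prop := forall w, 0 < w -> continuous f w.

Lemma ex_RInt_pos (f : R -> R) (a b : R) :
  continuous_pos f -> 0 < a -> a <= b -> ex_RInt f a b.
Proof.
  intros Hf Ha Hab. apply (ex_RInt_continuous (V := R_CompleteNormedModule)).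
  intros z Hz. apply Hf. rewrite Rmin_left in Hz by lra. lra.
Qed.

Lemma continuous_pos_plus (f g : R -> R) :
  continuous_pos f -> continuous_pos g -> continuous_pos (fun w => f w + g w).
Proof.
  intros Hf Hg w Hw.
  apply (continuous_plus (V := R_NormedModule) f g); [apply Hf|apply Hg]; exact Hw.
Qed.

(** Side conditions on [is_RInt_gen] come as events of this product filter; explicit thresholds are
    easier to supply, and the choice 1, 1 already forces [a <= b]. *)
Lemma eventually_improper (P : R -> R -> Prop) (a0 b0 : R) :
  0 < a0 ->
  (forall a b, 0 < a <= a0 -> b0 <= b -> P a b) ->
  filter_prod (at_right 0) (Rbar_locally p_infty) (fun ab => P (fst ab) (snd ab)).
Proof.
  intros Ha0 H.
  apply (Filter_prod _ _ _ (fun a => 0 < a <= a0) (fun b => b0 < b)).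
  - exists (mkposreal a0 Ha0). intros y Hy Hy0. split; [exact Hy0|].
    unfold ball in Hy; simpl in Hy; unfold AbsRing_ball, abs, minus, plus, opp in Hy;
      simpl in Hy.
    apply Rabs_def2 in Hy. lra.
  - exists b0. intros y Hy. exact Hy.
  - intros a b Ha Hb. simpl. apply H; [exact Ha|lra].
Qed.

Lemma improper_ext (f g : R -> R) (l : R) :
  (forall w, 0 < w -> f w = g w) -> improper f l -> improper g l.
Proof.
  intros H Hf. refine (is_RInt_gen_ext _ _ _ _ Hf).
  apply (eventually_improper
    (fun a b => forall w, Rmin a b < w < Rmax a b -> f w = g w) 1 1); [lra|].
  intros a b Ha Hb w Hw. apply H.
  rewrite Rmin_left in Hw by lra. lra.
Qed.

Lemma improper_plus (f g : R -> R) (lf lg : R) :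
  improper f lf -> improper g lg -> improper (fun w => f w + g w) (lf + lg).
Proof. exact (is_RInt_gen_plus f g lf lg). Qed.

Lemma improper_scal (f : R -> R) (k l : R) :
  improper f l -> improper (fun w => k * f w) (k * l).
Proof. exact (is_RInt_gen_scal f k l). Qed.

Lemma improper_minus (f g : R -> R) (lf lg : R) :
  improper f lf -> improper g lg -> improper (fun w => f w - g w) (lf - lg).
Proof. exact (is_RInt_gen_minus f g lf lg). Qed.

Lemma improper_unique (f : R -> R) (l1 l2 : R) :
  improper f l1 -> improper f l2 -> l1 = l2.
Proof.
  intros H1 H2.
  rewrite <- (is_RInt_gen_unique (V := R_CompleteNormedModule) f l1 H1).
  exact (is_RInt_gen_unique (V := R_CompleteNormedModule) f l2 H2).
Qed.

Lemma improper_intro (f : R -> R) (l : R) :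
  continuous_pos f ->
  (forall eps, 0 < eps -> exists a0 b0, 0 < a0 <= b0 /\
     forall a b, 0 < a <= a0 -> b0 <= b -> Rabs (RInt f a b - l) < eps) ->
  improper f l.
Proof.
  intros Hf H P [eps HP].
  destruct (H eps (cond_pos eps)) as (a0 & b0 & Hab & H0).
  apply (eventually_improper (fun a b => exists y, is_RInt f a b y /\ P y) a0 b0);
    [lra|].
  intros a b Ha Hb. exists (RInt f a b). split.
  - apply (RInt_correct (V := R_CompleteNormedModule)). apply ex_RInt_pos; [exact Hf|lra|lra].
  - apply HP. apply H0; assumption.
Qed.

Lemma improper_derive (F f : R -> R) (la lb : R) :
  (forall w, 0 < w -> is_derive F w (f w)) -> continuous_pos f ->
  filterlim F (at_right 0) (locally la) ->
  filterlim F (Rbar_locally p_infty) (locally lb) ->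
  improper f (lb - la).
Proof.
  intros HF Hf Ha Hb.
  apply improper_ext with (Derive F).
  { intros w Hw. apply is_derive_unique. now apply HF. }
  apply is_RInt_gen_Derive; [| |exact Ha|exact Hb].
  - apply (eventually_improper
      (fun a b => forall x, Rmin a b <= x <= Rmax a b -> ex_derive F x) 1 1); [lra|].
    intros a b Ha0 Hb0 x Hx. rewrite Rmin_left in Hx by lra.
    exists (f x). apply HF. lra.
  - apply (eventually_improper
      (fun a b => forall x, Rmin a b <= x <= Rmax a b -> continuous (Derive F) x) 1 1);
      [lra|].
    intros a b Ha0 Hb0 x Hx. rewrite Rmin_left in Hx by lra.
    assert (Hx0 : 0 < x) by lra.
    apply (continuous_ext_loc _ f); [|now apply Hf].
    (* The ball of radius [x] around [x] has only positive points, where [Derive F] equals [f]. *)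
    exists (mkposreal x Hx0). intros y Hy.
    unfold ball in Hy; simpl in Hy; unfold AbsRing_ball, abs, minus, plus, opp in Hy;
      simpl in Hy.
    apply Rabs_def2 in Hy. symmetry. apply is_derive_unique. apply HF. lra.
Qed.

Lemma improper_abs_le (f g : R -> R) (lf lg : R) :
  (forall w, 0 < w -> Rabs (f w) <= g w) ->
  improper f lf -> improper g lg -> Rabs lf <= lg.
Proof.
  intros H Hf Hg.
  refine (RInt_gen_norm (V := R_CompleteNormedModule) f g lf lg _ _ Hf Hg).
  - apply (eventually_improper (fun a b => a <= b) 1 1); intros; lra.
  - apply (eventually_improper (fun a b => forall x, a <= x <= b -> norm (f x) <= g x) 1 1);
      [lra|].
    intros a b Ha Hb x Hx. apply H. lra.
Qed.

(** The nonnegative function [g - f] serves as its own bound in [improper_abs_le], which gives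
    [|lg - lf| <= lg - lf]. *)
Lemma improper_le (f g : R -> R) (lf lg : R) :
  (forall w, 0 < w -> f w <= g w) -> improper f lf -> improper g lg -> lf <= lg.
Proof.
  intros H Hf Hg.
  assert (0 <= lg - lf); [|lra].
  apply Rle_trans with (Rabs (lg - lf)); [apply Rabs_pos|].
  refine (improper_abs_le _ _ _ _ _ (improper_minus _ _ _ _ Hg Hf)
    (improper_minus _ _ _ _ Hg Hf)).
  intros w Hw. specialize (H w Hw). simpl. rewrite Rabs_pos_eq; lra.
Qed.

(** Integrals over compact intervals grow with the interval, so they converge to their supremum. *)
Lemma improper_nonneg_exists (f : R -> R) (B : R) :
  continuous_pos f -> (forall w, 0 < w -> 0 <= f w) ->
  (forall a b, 0 < a <= b -> RInt f a b <= B) ->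
  exists l, improper f l.
Proof.
  intros Hf Hpos HB.
  destruct (completeness (fun r => exists a b, 0 < a <= b /\ r = RInt f a b))
    as [l [Hub Hlub]].
  - exists B. intros r (a & b & Hab & ->). now apply HB.
  - exists (RInt f 1 1). exists 1, 1. split; [lra|reflexivity].
  - exists l. apply improper_intro; [exact Hf|].
    intros eps Heps.
    (* If no compact interval had integral above [l - eps], then [l - eps] would be an upper bound
       below the least one. *)
    destruct (Classical_Prop.classic
      (exists a0 b0, 0 < a0 <= b0 /\ l - eps < RInt f a0 b0)) as [(a0 & b0 & Hab & H0)|Hn].
    + exists a0, b0. split; [exact Hab|]. intros a b Ha Hb.
      assert (RInt f a b <= l).
      { apply Hub. exists a, b. split; [lra|reflexivity]. }
      assert (RInt f a0 b0 <= RInt f a b).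
      { rewrite <- (RInt_Chasles f a a0 b) by (apply ex_RInt_pos; [exact Hf|lra|lra]).
        rewrite <- (RInt_Chasles f a0 b0 b) by (apply ex_RInt_pos; [exact Hf|lra|lra]).
        assert (0 <= RInt f a a0).
        { apply RInt_ge_0; [lra|apply ex_RInt_pos; [exact Hf|lra|lra]|].
          intros; apply Hpos; lra. }
        assert (0 <= RInt f b0 b).
        { apply RInt_ge_0; [lra|apply ex_RInt_pos; [exact Hf|lra|lra]|].
          intros; apply Hpos; lra. }
        unfold plus; simpl. lra. }
      apply Rabs_def1; lra.
    + exfalso. assert (l <= l - eps); [|lra].
      apply Hlub. intros r (a & b & Hab & ->).
      apply Rnot_lt_le. intros H. apply Hn. exists a, b. now split.
Qed.

(** Since [0 <= f + g <= 2 g], the nonnegative case applies to [f + g] and to [g]; then subtract. *)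
Lemma improper_dominated (f g : R -> R) (B : R) :
  continuous_pos f -> continuous_pos g ->
  (forall w, 0 < w -> Rabs (f w) <= g w) ->
  (forall a b, 0 < a <= b -> RInt g a b <= B) ->
  exists l, improper f l.
Proof.
  intros Hf Hg Hfg HB.
  assert (Hpos : forall w, 0 < w -> 0 <= g w).
  { intros w Hw. apply Rle_trans with (2 := Hfg w Hw), Rabs_pos. }
  destruct (improper_nonneg_exists g B Hg Hpos HB) as [lg Hlg].
  destruct (improper_nonneg_exists (fun w => f w + g w) (2 * B)) as [l Hl].
  - now apply continuous_pos_plus.
  - intros w Hw. generalize (Hfg w Hw). intros H. apply Rabs_le_between in H. lra.
  - intros a b Hab.
    apply Rle_trans with (RInt (fun w => 2 * g w) a b).
    + apply RInt_le; [lra| | |].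
      * apply ex_RInt_pos; [now apply continuous_pos_plus|lra|lra].
      * apply (ex_RInt_scal (V := R_NormedModule) g). apply ex_RInt_pos; [exact Hg|lra|lra].
      * intros w Hw. generalize (Hfg w ltac:(lra)). intros H.
        apply Rabs_le_between in H. lra.
    + rewrite (RInt_scal (V := R_CompleteNormedModule) g)
        by (apply ex_RInt_pos; [exact Hg|lra|lra]).
      unfold scal; simpl; unfold mult; simpl. generalize (HB a b Hab). lra.
  - exists (l - lg). apply improper_ext with (fun w => (f w + g w) - g w).
    + intros; ring.
    + now apply improper_minus.
Qed.

(** * Bounds on the Gamma kernel and a convergence test *)

(** Tangent line of the concave [ln] at [p], from [1 + v <= e^v] at [v = ln (y/p)]. Choosing [p]
    well gives the sharp constants below. *)
Lemma ln_le_linear (p y : R) : 0 < p -> 0 < y -> ln y <= y / p - 1 + ln p.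
Proof.
  intros Hp Hy.
  assert (H : 0 < y / p) by (now apply Rdiv_lt_0_compat).
  generalize (exp_ineq1_le (ln (y / p))). rewrite exp_ln by exact H.
  rewrite ln_div by assumption. lra.
Qed.

Lemma Rpower_gt_0 (x y : R) : 0 < Rpower x y.
Proof. apply exp_pos. Qed.

Lemma is_derive_Rpower (s w : R) :
  0 < w -> is_derive (fun x => Rpower x s) w (s * Rpower w (s - 1)).
Proof. intros Hw. apply is_derive_Reals. now apply derivable_pt_lim_power. Qed.

Lemma continuous_pos_mult (f g : R -> R) :
  continuous_pos f -> continuous_pos g -> continuous_pos (fun w => f w * g w).
Proof.
  intros Hf Hg w Hw.
  apply (continuous_mult (K := R_AbsRing) f g); [apply Hf|apply Hg]; exact Hw.
Qed.

Lemma continuous_pos_derivable (f : R -> R) :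
  (forall w, 0 < w -> ex_derive f w) -> continuous_pos f.
Proof.
  intros H w Hw. apply (ex_derive_continuous (V := R_NormedModule)). now apply H.
Qed.

(** Trades the exponential for a power of [1 + w], because the new kernel has an elementary
    primitive. The constant is the maximum of [e^(-c w) (1+w)^(s+1)] over [1 + w > 0], attained at
    [1 + w = (s+1)/c]. *)
Lemma kernel_le (c s w : R) : 0 < c -> 0 < s -> 0 < w ->
  exp (- (c * w)) * Rpower w (s - 1) <=
  exp (c + (s + 1) * (ln ((s + 1) / c) - 1)) *
    (Rpower w (s - 1) * Rpower (1 + w) (- s - 1)).
Proof.
  intros Hc Hs Hw.
  rewrite (Rmult_comm (exp _)), (Rmult_comm (exp (c + _))), Rmult_assoc.
  apply Rmult_le_compat_l; [left; apply Rpower_gt_0|].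
  unfold Rpower. rewrite <- exp_plus.
  assert (H : - (c * w) <= (- s - 1) * ln (1 + w) + (c + (s + 1) * (ln ((s + 1) / c) - 1))).
  { assert (Hp : 0 < (s + 1) / c) by (apply Rdiv_lt_0_compat; lra).
    generalize (ln_le_linear _ (1 + w) Hp ltac:(lra)). intros H.
    apply (Rmult_le_compat_l (s + 1)) in H; [|lra].
    replace ((s + 1) * ((1 + w) / ((s + 1) / c) - 1 + ln ((s + 1) / c))) with
      (c * (1 + w) + (s + 1) * (ln ((s + 1) / c) - 1)) in H by (field; lra).
    lra. }
  destruct H as [H| ->]; [left; now apply exp_increasing|right; reflexivity].
Qed.

(* [s w^(s-1) (1+w)^(-s-1)] is the derivative of [(w/(1+w))^s], which lies in [0,1]. *)
Lemma RInt_beta_le (s a b : R) : 0 < s -> 0 < a <= b ->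
  RInt (fun w => Rpower w (s - 1) * Rpower (1 + w) (- s - 1)) a b <= / s.
Proof.
  intros Hs Hab.
  assert (H : is_RInt (fun w => s * (Rpower w (s - 1) * Rpower (1 + w) (- s - 1))) a b
    (Rpower b s * Rpower (1 + b) (- s) - Rpower a s * Rpower (1 + a) (- s))).
  { apply (is_RInt_derive (V := R_CompleteNormedModule)
      (fun w => Rpower w s * Rpower (1 + w) (- s))).
    - intros w Hw. rewrite Rmin_left in Hw by lra.
      evar_last.
      { apply (is_derive_mult (K := R_AbsRing) (fun w => Rpower w s)
          (fun w => Rpower (1 + w) (- s))); [apply is_derive_Rpower; lra| |exact Rmult_comm].
        apply (is_derive_comp (fun y => Rpower y (- s)) (fun w => 1 + w)).
        - apply is_derive_Rpower. lra.
        - auto_derive; [exact I|reflexivity]. }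
      unfold plus, mult, scal; simpl; unfold mult; simpl.
      replace (Rpower w s) with (Rpower w (s - 1) * w).
      2:{ rewrite <- (Rpower_1 w) at 2 by lra. rewrite <- Rpower_plus. f_equal; ring. }
      replace (Rpower (1 + w) (- s)) with (Rpower (1 + w) (- s - 1) * (1 + w)).
      2:{ rewrite <- (Rpower_1 (1 + w)) at 2 by lra. rewrite <- Rpower_plus.
          f_equal; ring. }
      ring.
    - intros w Hw. rewrite Rmin_left in Hw by lra.
      apply (ex_derive_continuous (V := R_NormedModule)). unfold Rpower.
      auto_derive. lra. }
  assert (Hc : continuous_pos (fun w => Rpower w (s - 1) * Rpower (1 + w) (- s - 1))).
  { apply continuous_pos_derivable. intros w Hw. unfold Rpower. auto_derive. lra. }
  apply (is_RInt_unique (V := R_CompleteNormedModule)) in H.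
  rewrite (RInt_scal (V := R_CompleteNormedModule)) in H by (apply ex_RInt_pos; [exact Hc|lra|lra]).
  unfold scal in H; simpl in H; unfold mult in H; simpl in H.
  assert (Hb : Rpower b s * Rpower (1 + b) (- s) <= 1).
  { rewrite Rpower_Ropp. apply (Rmult_le_reg_r (Rpower (1 + b) s)); [apply Rpower_gt_0|].
    rewrite Rmult_assoc, Rinv_l by (apply Rgt_not_eq, Rpower_gt_0).
    rewrite Rmult_1_r, Rmult_1_l. apply Rle_Rpower_l; lra. }
  assert (Ha : 0 < Rpower a s * Rpower (1 + a) (- s)) by
    (apply Rmult_lt_0_compat; apply Rpower_gt_0).
  apply (Rmult_le_reg_l s); [lra|]. rewrite Rinv_r by lra.
  apply Rle_trans with (2 := Hb).
  match type of H with ?l = _ => change (l <= Rpower b s * Rpower (1 + b) (- s)) end.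
  lra.
Qed.

Lemma improper_exists (f : R -> R) (C c s : R) :
  0 < c -> 0 < s -> 0 <= C -> continuous_pos f ->
  (forall w, 0 < w -> Rabs (f w) <= C * (exp (- (c * w)) * Rpower w (s - 1))) ->
  exists l, improper f l.
Proof.
  intros Hc Hs HC Hf H.
  set (K := C * exp (c + (s + 1) * (ln ((s + 1) / c) - 1))).
  assert (HK : 0 <= K) by (apply Rmult_le_pos; [exact HC|left; apply exp_pos]).
  assert (Hcont : continuous_pos (fun w => Rpower w (s - 1) * Rpower (1 + w) (- s - 1))).
  { apply continuous_pos_derivable. intros w Hw. unfold Rpower. auto_derive. lra. }
  apply (improper_dominated f (fun w => K * (Rpower w (s - 1) * Rpower (1 + w) (- s - 1)))
    (K * / s)).
  - exact Hf.
  - apply continuous_pos_mult; [|exact Hcont]. intros w _. apply continuous_const.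
  - intros w Hw. apply Rle_trans with (1 := H w Hw). unfold K. rewrite Rmult_assoc.
    apply Rmult_le_compat_l; [exact HC|]. now apply kernel_le.
  - intros a b Hab. rewrite (RInt_scal (V := R_CompleteNormedModule))
      by (apply ex_RInt_pos; [exact Hcont|lra|lra]).
    apply Rmult_le_compat_l; [exact HK|]. now apply RInt_beta_le.
Qed.

(** * Euler's Gamma integral and its functional equation *)

(** [RInt_gen] is total, so the value has its meaning only where the integral converges;
    [improper_Gamma] provides this for [0 < s]. *)
Definition Gamma_int (s : R) : R :=
  RInt_gen (fun w => exp (- w) * Rpower w (s - 1)) (at_right 0) (Rbar_locally p_infty).

Lemma continuous_pos_kernel (s : R) :
  continuous_pos (fun w => exp (- w) * Rpower w (s - 1)).
Proof.
  apply continuous_pos_derivable. intros w Hw. unfold Rpower. auto_derive. lra.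
Qed.

Lemma improper_Gamma (s : R) :
  0 < s -> improper (fun w => exp (- w) * Rpower w (s - 1)) (Gamma_int s).
Proof.
  intros Hs. unfold improper, Gamma_int.
  apply (RInt_gen_correct (V := R_CompleteNormedModule)).
  apply (improper_exists _ 1 1 s); [lra|lra|lra|apply continuous_pos_kernel|].
  intros w Hw. rewrite 2!Rmult_1_l. right. apply Rabs_pos_eq.
  apply Rmult_le_pos; left; [apply exp_pos|apply Rpower_gt_0].
Qed.

Lemma Rpower_at_right_0 (s : R) : 0 < s ->
  filterlim (fun w => Rpower w s) (at_right 0) (locally 0).
Proof.
  intros Hs. apply filterlim_locally. intros eps.
  (* The radius [eps^(1/s)] is the point where [w^s] reaches [eps]. *)
  exists (mkposreal _ (Rpower_gt_0 eps (/ s))). intros w Hw Hw0.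
  unfold ball in *; simpl in *; unfold AbsRing_ball, abs, minus, plus, opp in *;
    simpl in *.
  apply Rabs_def2 in Hw.
  rewrite Ropp_0, Rplus_0_r, Rabs_pos_eq by (left; apply Rpower_gt_0).
  replace (pos eps) with (Rpower (Rpower eps (/ s)) s).
  - apply Rlt_Rpower_l; [exact Hs|lra].
  - rewrite Rpower_mult, Rinv_l, Rpower_1 by (try apply cond_pos; lra). reflexivity.
Qed.

Lemma exp_Rpower_at_right_0 (s : R) : 0 < s ->
  filterlim (fun w => exp (- w) * Rpower w s) (at_right 0) (locally 0).
Proof.
  intros Hs. apply filterlim_locally. intros eps.
  generalize (proj1 (filterlim_locally _ _) (Rpower_at_right_0 s Hs) eps).
  intros [d Hd]. exists d. intros w Hw Hw0. specialize (Hd w Hw Hw0).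
  unfold ball in *; simpl in *; unfold AbsRing_ball, abs, minus, plus, opp in *;
    simpl in *.
  rewrite Ropp_0, Rplus_0_r in *. apply Rle_lt_trans with (2 := Hd).
  rewrite Rabs_mult. rewrite <- (Rmult_1_l (Rabs (Rpower w s))) at 2.
  apply Rmult_le_compat_r; [apply Rabs_pos|].
  rewrite Rabs_pos_eq by (left; apply exp_pos).
  rewrite <- exp_0. left. apply exp_increasing. lra.
Qed.

(** The function is at most [K / w], where [K] is the maximum of [e^-w w^(s+1)], attained at
    [w = s + 1]. *)
Lemma exp_Rpower_at_infty (s : R) : 0 < s ->
  filterlim (fun w => exp (- w) * Rpower w s) (Rbar_locally p_infty) (locally 0).
Proof.
  intros Hs.
  set (K := exp ((s + 1) * (ln (s + 1) - 1))).
  assert (HK : 0 < K) by apply exp_pos.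
  assert (H : forall w, 0 < w -> exp (- w) * Rpower w s <= K * / w).
  { intros w Hw.
    rewrite <- (exp_ln (/ w)) by (now apply Rinv_0_lt_compat).
    rewrite ln_Rinv by exact Hw. unfold K, Rpower. rewrite <- 2!exp_plus.
    assert (H : - w + s * ln w <= (s + 1) * (ln (s + 1) - 1) + - ln w).
    { generalize (ln_le_linear (s + 1) w ltac:(lra) Hw). intros H.
      apply (Rmult_le_compat_l (s + 1)) in H; [|lra].
      replace ((s + 1) * (w / (s + 1) - 1 + ln (s + 1))) with
        (w + (s + 1) * (ln (s + 1) - 1)) in H by (field; lra). lra. }
    destruct H as [H| ->]; [left; now apply exp_increasing|right; reflexivity]. }
  apply filterlim_locally. intros eps. exists (K / eps). intros w Hw.
  assert (Heps := cond_pos eps).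
  assert (Hw0 : 0 < w).
  { apply Rlt_trans with (2 := Hw). now apply Rdiv_lt_0_compat. }
  unfold ball; simpl; unfold AbsRing_ball, abs, minus, plus, opp; simpl.
  rewrite Ropp_0, Rplus_0_r, Rabs_pos_eq.
  2:{ apply Rmult_le_pos; left; [apply exp_pos|apply Rpower_gt_0]. }
  apply Rle_lt_trans with (1 := H w Hw0).
  apply (Rmult_lt_reg_r w); [exact Hw0|]. rewrite Rmult_assoc, Rinv_l by lra.
  apply (Rmult_lt_compat_r eps) in Hw; [|exact Heps].
  unfold Rdiv in Hw. rewrite Rmult_assoc, Rinv_l in Hw by lra. lra.
Qed.

(** Integration by parts: [e^-w w^s] tends to 0 at both ends, so its derivative integrates to 0. *)
Lemma Gamma_int_succ (s : R) : 0 < s -> Gamma_int (s + 1) = s * Gamma_int s.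
Proof.
  intros Hs.
  assert (H : improper (fun w => - exp (- w) * Rpower w s + s * (exp (- w) * Rpower w (s - 1)))
    (0 - 0)).
  { apply improper_derive with (fun w => exp (- w) * Rpower w s).
    - intros w Hw. evar_last.
      { apply (is_derive_mult (K := R_AbsRing) (fun w => exp (- w))
          (fun w => Rpower w s)); [|now apply is_derive_Rpower|exact Rmult_comm].
        auto_derive; [exact I|reflexivity]. }
      unfold plus, mult; simpl. ring.
    - apply continuous_pos_derivable. intros w Hw. unfold Rpower. auto_derive. lra.
    - now apply exp_Rpower_at_right_0.
    - now apply exp_Rpower_at_infty. }
  assert (H1 := improper_Gamma (s + 1) ltac:(lra)).
  assert (H2 := improper_scal _ s _ (improper_Gamma s Hs)).
  assert (H3 := improper_plus _ _ _ _ H1 H).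
  assert (H4 : Gamma_int (s + 1) + (0 - 0) = s * Gamma_int s); [|lra].
  apply (improper_unique _ _ _ H3). revert H2. apply improper_ext.
  intros w Hw. simpl. replace (s + 1 - 1) with s by ring. ring.
Qed.

Lemma Gamma_int_1 : Gamma_int 1 = 1.
Proof.
  assert (H : improper (fun w => exp (- w)) (0 - -1)).
  { apply improper_derive with (fun w => - exp (- w)).
    - intros w Hw. auto_derive; [exact I|ring].
    - apply continuous_pos_derivable. intros w Hw. auto_derive. exact I.
    - refine (filterlim_filter_le_1 _ (filter_le_within _) _).
      replace (-1) with (- exp (- 0)) by (rewrite Ropp_0, exp_0; ring).
      apply (ex_derive_continuous (V := R_NormedModule) (fun w => - exp (- w))).
      auto_derive. exact I.
    - replace 0 with (- 0) by ring.
      apply (filterlim_comp _ _ _ (fun w => exp (- w)) Ropp _ (locally 0)).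
      + apply (filterlim_comp _ _ _ Ropp exp _ (Rbar_locally m_infty)).
        * apply (filterlim_Rbar_opp p_infty).
        * apply is_lim_exp_m.
      + apply (filterlim_opp (V := R_NormedModule) 0). }
  apply (improper_unique _ _ 1 (improper_Gamma 1 ltac:(lra))).
  replace (0 - -1) with 1 in H by ring. revert H. apply improper_ext.
  intros w Hw. rewrite Rminus_diag_eq by reflexivity. rewrite Rpower_O by exact Hw. ring.
Qed.

(** * Wendel's inequality and the limit of the Gauss quotients *)

(** The right side is the tangent of [w^s] at [w = p]. Scaling by [p] reduces the claim to
    [v^s <= 1 - s + s v] with [v = w/p]. *)
Lemma Rpower_le_tangent (p s w : R) : 0 < p -> 0 < w -> 0 <= s <= 1 ->
  Rpower w s <= Rpower p s * (1 - s) + Rpower p s * s / p * w.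
Proof.
  intros Hp Hw Hs.
  replace w with (p * (w / p)) at 1 by (field; lra).
  assert (Hwp : 0 < w / p) by (now apply Rdiv_lt_0_compat).
  rewrite <- Rpower_mult_distr by assumption.
  replace (Rpower p s * (1 - s) + Rpower p s * s / p * w) with
    (Rpower p s * (1 - s + s * (w / p))) by (field; lra).
  apply Rmult_le_compat_l; [left; apply Rpower_gt_0|].
  assert (Hy : 0 < 1 - s + s * (w / p)).
  { destruct (Req_dec s 0) as [->|]; [lra|].
    assert (0 < s * (w / p)) by (apply Rmult_lt_0_compat; lra). lra. }
  (* weighted AM-GM, through [ln v <= v/y - 1 + ln y] at [v = 1] and [v = w/p] *)
  set (y := 1 - s + s * (w / p)) in *.
  assert (E1 := ln_le_linear y 1 Hy Rlt_0_1). rewrite ln_1 in E1.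
  assert (E2 := ln_le_linear y (w / p) Hy Hwp).
  assert (E3 : s * ln (w / p) <= ln y).
  { apply (Rmult_le_compat_l (1 - s)) in E1; [|lra].
    apply (Rmult_le_compat_l s) in E2; [|lra].
    assert (E4 : (1 - s) * (1 / y) + s * (w / p / y) = 1).
    { replace ((1 - s) * (1 / y) + s * (w / p / y)) with ((1 - s + s * (w / p)) / y)
        by (field; split; lra).
      fold y. field. lra. }
    lra. }
  unfold Rpower. rewrite <- (exp_ln y) by exact Hy.
  destruct E3 as [E3| ->]; [left; now apply exp_increasing|right; reflexivity].
Qed.

(* Integrate the tangent bound [w^s <= p^s + s p^(s-1) (w - p)] of the concave function
   [w^s] against [e^-w w^(p-1)]: the linear term has mean zero. *)
Lemma Gamma_int_le (p s : R) :
  0 < p -> 0 <= s <= 1 -> Gamma_int (p + s) <= Rpower p s * Gamma_int p.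
Proof.
  intros Hp Hs.
  assert (H1 := improper_Gamma p Hp).
  assert (H2 := improper_Gamma (p + 1) ltac:(lra)).
  assert (H3 := improper_plus _ _ _ _ (improper_scal _ (Rpower p s * (1 - s)) _ H1)
    (improper_scal _ (Rpower p s * s / p) _ H2)).
  assert (H4 := improper_Gamma (p + s) ltac:(lra)).
  replace (Rpower p s * Gamma_int p) with
    (Rpower p s * (1 - s) * Gamma_int p + Rpower p s * s / p * Gamma_int (p + 1)).
  2:{ rewrite Gamma_int_succ by exact Hp. field. lra. }
  refine (improper_le _ _ _ _ _ H4 H3). intros w Hw. cbv beta.
  replace (p + s - 1) with (s + (p - 1)) by ring.
  replace (p + 1 - 1) with (1 + (p - 1)) by ring.
  rewrite 2!Rpower_plus, (Rpower_1 w) by exact Hw.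
  assert (H := Rpower_le_tangent p s w Hp Hw Hs).
  apply (Rmult_le_compat_l (exp (- w) * Rpower w (p - 1))) in H.
  - lra.
  - apply Rmult_le_pos; left; [apply exp_pos|apply Rpower_gt_0].
Qed.

Lemma is_lim_seq_div_INR (c : R) : is_lim_seq (fun n => c / INR n) 0.
Proof.
  apply (is_lim_seq_ext (fun n => c * / INR n)); [reflexivity|].
  replace (Finite 0) with (Rbar_mult c 0) by (simpl; f_equal; ring).
  apply is_lim_seq_scal_l.
  replace (Finite 0) with (Rbar_inv p_infty) by reflexivity.
  apply is_lim_seq_inv; [apply is_lim_seq_INR|discriminate].
Qed.

Lemma Gamma_int_rising (s : R) (n : nat) : 0 < s ->
  Gamma_int (s + INR n + 1) = rising_prod s n * Gamma_int s.
Proof.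
  intros Hs. induction n as [|n IH].
  - simpl rising_prod. rewrite Rplus_0_r. now apply Gamma_int_succ.
  - rewrite Gamma_int_succ by (generalize (pos_INR (S n)); lra).
    change (rising_prod s (S n)) with (rising_prod s n * (s + INR (S n))).
    rewrite S_INR. rewrite <- Rplus_assoc, IH. ring.
Qed.

Lemma Gamma_int_fact (n : nat) : Gamma_int (INR n + 1) = INR (fact n).
Proof.
  induction n as [|n IH].
  - simpl. rewrite Rplus_0_l. apply Gamma_int_1.
  - rewrite S_INR, Gamma_int_succ by (generalize (pos_INR n); lra).
    rewrite IH, fact_simpl, mult_INR, S_INR. reflexivity.
Qed.

(** The sequence whose limit is [rgamma z]. For [z > 0], its product with [Gamma_int z] is
    [Gamma (z+n+1) / (n! n^z)]. *)
Definition gauss_quotient (z : R) (n : nat) : R :=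
  rising_prod z n / (INR (fact n) * Rpower (INR n) z).

(** Wendel's inequality, used once below and once above [Gamma (s+n+1)], squeezes the sequence
    between [1 - 1/n] and [1 + 1/n]. *)
Lemma gauss_quotient_lim_unit (s : R) : 0 < s <= 1 ->
  is_lim_seq (fun n => gauss_quotient s n * Gamma_int s) 1.
Proof.
  intros Hs.
  apply is_lim_seq_le_le_loc with (u := fun n => 1 - 1 / INR n) (w := fun n => 1 + 1 / INR n).
  - exists 1%nat. intros n Hn. unfold gauss_quotient.
    assert (Hn0 : 0 < INR n) by (apply lt_0_INR; lia).
    assert (Hf : 0 < INR (fact n)) by apply INR_fact_lt_0.
    assert (Hp : 0 < Rpower (INR n) s) by apply Rpower_gt_0.
    replace (rising_prod s n / (INR (fact n) * Rpower (INR n) s) * Gamma_int s) with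
      (rising_prod s n * Gamma_int s / (INR (fact n) * Rpower (INR n) s))
      by (field; split; lra).
    rewrite <- Gamma_int_rising by lra.
    split.
    (* A step of length [1 - s] from [s + n + 1] ends at the integer [n + 2], so
       [(n+1)! <= (s+n+1)^(1-s) Gamma (s+n+1)]. *)
    + assert (H := Gamma_int_le (s + INR n + 1) (1 - s) ltac:(lra) ltac:(lra)).
      replace (s + INR n + 1 + (1 - s)) with (INR (S n) + 1) in H by (rewrite S_INR; ring).
      rewrite Gamma_int_fact, fact_simpl, mult_INR, S_INR in H.
      set (G := Gamma_int (s + INR n + 1)) in *.
      assert (HG : 0 < G).
      { apply (Rmult_lt_reg_l (Rpower (s + INR n + 1) (1 - s))); [apply Rpower_gt_0|].
        apply Rlt_le_trans with (2 := H). rewrite Rmult_0_r.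
        apply Rmult_lt_0_compat; lra. }
      (* Both bases are at most [n + 2], and the exponents add up to 1. *)
      assert (H2 : Rpower (INR n) s * Rpower (s + INR n + 1) (1 - s) <= INR n + 2).
      { rewrite <- (Rpower_1 (INR n + 2)) by lra.
        replace 1 with (s + (1 - s)) at 3 by ring. rewrite Rpower_plus.
        apply Rmult_le_compat; try (left; apply Rpower_gt_0); apply Rle_Rpower_l; lra. }
      apply Rle_trans with ((INR n + 1) / (INR n + 2)).
      { apply (Rmult_le_reg_r (INR n * (INR n + 2))); [apply Rmult_lt_0_compat; lra|].
        replace ((1 - 1 / INR n) * (INR n * (INR n + 2))) with ((INR n - 1) * (INR n + 2))
          by (field; lra).
        replace ((INR n + 1) / (INR n + 2) * (INR n * (INR n + 2))) with
          ((INR n + 1) * INR n) by (field; lra). nra. }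
      apply (Rmult_le_reg_r ((INR n + 2) * (INR (fact n) * Rpower (INR n) s))).
      { repeat apply Rmult_lt_0_compat; lra. }
      replace ((INR n + 1) / (INR n + 2) * ((INR n + 2) * (INR (fact n) * Rpower (INR n) s)))
        with (Rpower (INR n) s * ((INR n + 1) * INR (fact n))) by (field; lra).
      replace (G / (INR (fact n) * Rpower (INR n) s) *
        ((INR n + 2) * (INR (fact n) * Rpower (INR n) s))) with ((INR n + 2) * G)
        by (field; lra).
      apply (Rmult_le_compat_l (Rpower (INR n) s)) in H; [|lra].
      apply Rle_trans with (1 := H). rewrite <- Rmult_assoc.
      apply Rmult_le_compat_r; [lra|exact H2].
    (* A step of length [s] from [n + 1] gives [Gamma (n+1+s) <= (n+1)^s n!]. *)
    + assert (H := Gamma_int_le (INR n + 1) s ltac:(lra) ltac:(lra)).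
      rewrite Gamma_int_fact in H.
      replace (s + INR n + 1) with (INR n + 1 + s) by ring.
      apply (Rmult_le_reg_r (INR (fact n) * Rpower (INR n) s));
        [apply Rmult_lt_0_compat; lra|].
      unfold Rdiv at 1. rewrite Rmult_assoc, Rinv_l, Rmult_1_r
        by (apply Rgt_not_eq, Rmult_lt_0_compat; lra).
      apply Rle_trans with (1 := H).
      replace (INR n + 1) with (INR n * (1 + 1 / INR n)) by (field; lra).
      assert (H1 : 0 < 1 / INR n) by (apply Rdiv_lt_0_compat; lra).
      rewrite <- Rpower_mult_distr by lra.
      assert (H2 : Rpower (1 + 1 / INR n) s <= 1 + 1 / INR n).
      { rewrite <- (Rpower_1 (1 + 1 / INR n)) at 2 by lra. apply Rle_Rpower; lra. }
      rewrite (Rmult_comm (Rpower (INR n) s)), Rmult_assoc, (Rmult_comm _ (INR (fact n))).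
      apply Rmult_le_compat_r; [apply Rmult_le_pos; lra|exact H2].
  - replace (Finite 1) with (Finite (1 - 0)) by (f_equal; ring).
    apply is_lim_seq_minus'; [apply is_lim_seq_const|apply is_lim_seq_div_INR].
  - replace (Finite 1) with (Finite (1 + 0)) by (f_equal; ring).
    apply is_lim_seq_plus'; [apply is_lim_seq_const|apply is_lim_seq_div_INR].
Qed.

(** Both sides are [s (s+1) ... (s+n+1)]. *)
Lemma rising_prod_succ (s : R) (n : nat) :
  s * rising_prod (s + 1) n = rising_prod s n * (s + INR n + 1).
Proof.
  induction n as [|n IH].
  - simpl. ring.
  - change (rising_prod (s + 1) (S n)) with (rising_prod (s + 1) n * (s + 1 + INR (S n))).
    change (rising_prod s (S n)) with (rising_prod s n * (s + INR (S n))).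
    rewrite <- Rmult_assoc, IH, S_INR. ring.
Qed.

(** Induction on an integer above [s]: passing from [s - 1] to [s] multiplies the sequence by
    [1 + s/n], which tends to 1. *)
Lemma gauss_quotient_lim (s : R) : 0 < s ->
  is_lim_seq (fun n => gauss_quotient s n * Gamma_int s) 1.
Proof.
  intros Hs. destruct (INR_unbounded s) as [N HN].
  revert s Hs HN. induction N as [|N IH]; intros s Hs HN; [simpl in HN; lra|].
  destruct (Rle_lt_dec s 1) as [H1|H1]; [apply gauss_quotient_lim_unit; lra|].
  rewrite S_INR in HN.
  specialize (IH (s - 1) ltac:(lra) ltac:(lra)).
  apply is_lim_seq_ext_loc with
    (fun n => gauss_quotient (s - 1) n * Gamma_int (s - 1) * (1 + s / INR n)).
  - exists 1%nat. intros n Hn.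
    assert (Hn0 : 0 < INR n) by (apply lt_0_INR; lia).
    assert (Hf : 0 < INR (fact n)) by apply INR_fact_lt_0.
    assert (Hp : 0 < Rpower (INR n) (s - 1)) by apply Rpower_gt_0.
    replace s with (s - 1 + 1) at 4 5 by ring.
    rewrite Gamma_int_succ by lra. unfold gauss_quotient.
    rewrite Rpower_plus, Rpower_1 by exact Hn0.
    assert (H := rising_prod_succ (s - 1) n).
    replace (rising_prod (s - 1 + 1) n / (INR (fact n) * (Rpower (INR n) (s - 1) * INR n)) *
      ((s - 1) * Gamma_int (s - 1))) with
      ((s - 1) * rising_prod (s - 1 + 1) n * Gamma_int (s - 1) /
         (INR (fact n) * (Rpower (INR n) (s - 1) * INR n))) by (field; lra).
    rewrite H. field. lra.
  - replace (Finite 1) with (Finite (1 * (1 + 0))) by (f_equal; ring).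
    apply is_lim_seq_mult'; [exact IH|].
    apply is_lim_seq_plus'; [apply is_lim_seq_const|apply is_lim_seq_div_INR].
Qed.

(** * Euler's sine product *)

Fixpoint sine_prod (s : R) (n : nat) : R :=
  match n with
  | O => s
  | S m => sine_prod s m * (1 - s ^ 2 / INR (S m) ^ 2)
  end.

(** The factors pair as [(k + s) (k - s) = k^2 (1 - s^2/k^2)] for [1 <= k <= n]; the first factor
    [s] and the last factor [n + 1 - s] stay unpaired. *)
Lemma rising_prod_reflection (s : R) (n : nat) :
  rising_prod s n * rising_prod (1 - s) n =
  sine_prod s n * INR (fact n) ^ 2 * (INR n + 1 - s).
Proof.
  induction n as [|n IH]; [simpl; ring|].
  change (rising_prod s (S n)) with (rising_prod s n * (s + INR (S n))).
  change (rising_prod (1 - s) (S n)) with (rising_prod (1 - s) n * (1 - s + INR (S n))).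
  change (sine_prod s (S n)) with (sine_prod s n * (1 - s ^ 2 / INR (S n) ^ 2)).
  replace (rising_prod s n * (s + INR (S n)) * (rising_prod (1 - s) n * (1 - s + INR (S n))))
    with (rising_prod s n * rising_prod (1 - s) n * (s + INR (S n)) * (1 - s + INR (S n)))
    by ring.
  rewrite IH, fact_simpl, mult_INR. rewrite S_INR. generalize (pos_INR n). intros Hn.
  field. lra.
Qed.

Definition cos_int (s : R) (n : nat) : R :=
  RInt (fun t => cos (2 * s * t) * cos t ^ (2 * n)) 0 (PI / 2).

Lemma ex_cos_int (s : R) (n : nat) (a b : R) :
  ex_RInt (fun t => cos (2 * s * t) * cos t ^ (2 * n)) a b.
Proof.
  apply (ex_RInt_continuous (V := R_CompleteNormedModule)). intros t _.
  apply (ex_derive_continuous (V := R_NormedModule)). auto_derive. exact I.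
Qed.

Lemma cos_int_succ (s : R) (n : nat) :
  4 * ((INR n + 1) ^ 2 - s ^ 2) * cos_int s (S n) =
  (2 * INR n + 2) * (2 * INR n + 1) * cos_int s n.
Proof.
  set (m := 2 * INR n + 2).
  assert (H : is_RInt (fun t => (m ^ 2 - 4 * s ^ 2) * (cos (2 * s * t) * cos t ^ (2 * S n)) -
      m * (m - 1) * (cos (2 * s * t) * cos t ^ (2 * n))) 0 (PI / 2) 0).
  (* Abstracting [2 n] to [k] exposes the exponent as [S (S k)], so that the powers unfold after
     differentiation. *)
  { replace (2 * S n)%nat with (S (S (2 * n))) by lia.
    assert (Hk : m = INR (2 * n) + 2) by (unfold m; rewrite mult_INR; simpl; ring).
    generalize dependent (2 * n)%nat. intros k Hk. clearbody m. subst m.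
    evar_last.
    (* One primitive combines both integrations by parts. It vanishes at 0 through the sines and at
       [PI/2] through the powers of [cos t]. *)
    - apply (is_RInt_derive (V := R_CompleteNormedModule)
        (fun t => (INR k + 2) * (cos (2 * s * t) * cos t ^ (S k) * sin t) -
                  2 * s * (sin (2 * s * t) * cos t ^ (S (S k))))).
      + intros t _. auto_derive; [exact I|].
        change (match k with O => 1 | S _ => INR k + 1 end) with (INR (S k)).
        rewrite S_INR. cbn [Nat.pred pow].
        generalize (sin2_cos2 t). unfold Rsqr. intros E.
        assert (E' : sin t * sin t = 1 - cos t * cos t) by lra.
        ring_simplify. replace (sin t ^ 2) with (1 - cos t * cos t) by (simpl; lra). ring.
      + intros t _. apply (ex_derive_continuous (V := R_NormedModule)).
        auto_derive. exact I.
    - unfold minus, plus, opp; cbn [pow].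
      rewrite cos_PI2, Rmult_0_r, !sin_0. simpl. ring. }
  apply (is_RInt_unique (V := R_CompleteNormedModule)) in H.
  rewrite (RInt_minus (V := R_CompleteNormedModule)) in H.
  2,3: apply (ex_RInt_scal (V := R_NormedModule)); apply ex_cos_int.
  rewrite 2!(RInt_scal (V := R_CompleteNormedModule)) in H by apply ex_cos_int.
  change ((m ^ 2 - 4 * s ^ 2) * cos_int s (S n) - m * (m - 1) * cos_int s n = 0) in H.
  unfold m in *. lra.
Qed.

Lemma cos_int_0 (s : R) : 2 * s * cos_int s 0 = sin (PI * s).
Proof.
  assert (H : is_RInt (fun t => 2 * s * (cos (2 * s * t) * cos t ^ (2 * 0))) 0 (PI / 2)
    (sin (PI * s))).
  { evar_last.
    - apply (is_RInt_derive (V := R_CompleteNormedModule) (fun t => sin (2 * s * t))).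
      + intros t _. auto_derive; [exact I|]. simpl. ring.
      + intros t _. apply (ex_derive_continuous (V := R_NormedModule)).
        auto_derive. exact I.
    - unfold minus, plus, opp; simpl. rewrite Rmult_0_r, sin_0, Ropp_0, Rplus_0_r.
      f_equal. field. }
  apply (is_RInt_unique (V := R_CompleteNormedModule)) in H.
  rewrite (RInt_scal (V := R_CompleteNormedModule)) in H by apply ex_cos_int.
  exact H.
Qed.

Lemma cos_int_0_0 : cos_int 0 0 = PI / 2.
Proof.
  unfold cos_int. rewrite (RInt_ext _ (fun _ => 1)).
  - rewrite (RInt_const (V := R_CompleteNormedModule)).
    unfold scal; simpl; unfold mult; simpl. ring.
  - intros t _. rewrite Rmult_0_r, Rmult_0_l, cos_0. simpl. ring.
Qed.

(** The case [s = 0] of [cos_int_succ], with a common factor [2n + 2] cancelled: the recursion of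
    the Wallis integrals. *)
Lemma wallis_succ (n : nat) :
  (2 * INR n + 2) * cos_int 0 (S n) = (2 * INR n + 1) * cos_int 0 n.
Proof.
  generalize (cos_int_succ 0 n) (pos_INR n). intros H Hn.
  apply (Rmult_eq_reg_l (2 * INR n + 2)); [|lra]. lra.
Qed.

Lemma wallis_gt_0 (n : nat) : 0 < cos_int 0 n.
Proof.
  induction n as [|n IH].
  - rewrite cos_int_0_0. generalize PI_RGT_0. lra.
  - generalize (wallis_succ n) (pos_INR n). intros H Hn.
    apply (Rmult_lt_reg_l (2 * INR n + 2)); [lra|]. rewrite H, Rmult_0_r.
    apply Rmult_lt_0_compat; lra.
Qed.

(** From [n] to [n + 1] both sides gain the factor [(2n+1)/(2n+2)]; the start is [cos_int_0]. The
    product form avoids dividing by [cos_int s n], which can be zero. *)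
Lemma sine_prod_cos_int (s : R) (n : nat) :
  PI * sine_prod s n * cos_int s n = sin (PI * s) * cos_int 0 n.
Proof.
  induction n as [|n IH].
  - rewrite cos_int_0_0. simpl sine_prod. rewrite <- cos_int_0. field.
  - change (sine_prod s (S n)) with (sine_prod s n * (1 - s ^ 2 / INR (S n) ^ 2)).
    rewrite S_INR. generalize (wallis_succ n) (cos_int_succ s n) (pos_INR n).
    intros H1 H2 Hn.
    replace (cos_int 0 (S n)) with ((2 * INR n + 1) * cos_int 0 n / (2 * INR n + 2))
      by (rewrite <- H1; field; lra).
    replace (PI * (sine_prod s n * (1 - s ^ 2 / (INR n + 1) ^ 2)) * cos_int s (S n)) with
      (PI * sine_prod s n * (4 * ((INR n + 1) ^ 2 - s ^ 2) * cos_int s (S n)) /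
         (4 * (INR n + 1) ^ 2)) by (field; lra).
    rewrite H2.
    replace (sin (PI * s) * ((2 * INR n + 1) * cos_int 0 n / (2 * INR n + 2))) with
      (sin (PI * s) * cos_int 0 n * ((2 * INR n + 1) / (2 * INR n + 2))) by (field; lra).
    rewrite <- IH. field. lra.
Qed.

(** The difference [sin t - t cos t] is 0 at 0 and has derivative [t sin t >= 0]. *)
Lemma mult_cos_le_sin (t : R) : 0 <= t <= PI / 2 -> t * cos t <= sin t.
Proof.
  intros Ht.
  destruct (MVT_gen (fun t => sin t - t * cos t) 0 t (fun t => t * sin t)) as [c [Hc H]].
  - intros x _. auto_derive; [exact I|ring].
  - intros x _. apply continuity_pt_filterlim.
    apply (ex_derive_continuous (V := R_NormedModule) (fun t => sin t - t * cos t)).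
    auto_derive. exact I.
  - rewrite Rmin_left, Rmax_right in Hc by lra. rewrite sin_0 in H.
    assert (0 <= c * sin c * (t - 0)); [|lra].
    apply Rmult_le_pos; [|lra]. apply Rmult_le_pos; [lra|].
    apply sin_ge_0; generalize PI_RGT_0; lra.
Qed.

(** Half-angle formula [1 - cos u = 2 sin^2 (u/2)], with [|sin v| <= |v|] from the mean value
    theorem. *)
Lemma one_minus_cos_le (u : R) : 0 <= 1 - cos u <= u ^ 2 / 2.
Proof.
  split; [generalize (COS_bound u); lra|].
  replace u with (2 * (u / 2)) at 1 by field. rewrite cos_2a_sin.
  destruct (MVT_gen sin 0 (u / 2) cos) as [c [_ H]].
  - intros x _. auto_derive; [exact I|ring].
  - intros x _. apply continuity_sin.
  - rewrite sin_0 in H. replace (sin (u / 2)) with (cos c * (u / 2)) by lra.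
    generalize (COS_bound c). intros Hc.
    assert (cos c ^ 2 <= 1) by nra.
    assert (0 <= u ^ 2) by apply pow2_ge_0.
    nra.
Qed.

(** Pointwise, [1 - cos (2 s t) <= 2 s^2 t^2] and [t^2 cos^2 t <= sin^2 t = 1 - cos^2 t]; the last
    factor turns the bound into a difference of consecutive Wallis integrals. *)
Lemma cos_int_bounds (s : R) (n : nat) :
  0 <= cos_int 0 (S n) - cos_int s (S n) <= 2 * s ^ 2 * (cos_int 0 n - cos_int 0 (S n)).
Proof.
  assert (HPI := PI_RGT_0).
  assert (Hcos : forall t, cos (2 * 0 * t) = 1).
  { intros t. rewrite Rmult_0_r, Rmult_0_l. apply cos_0. }
  assert (E1 : cos_int 0 (S n) - cos_int s (S n) = RInt (fun t =>
    cos (2 * 0 * t) * cos t ^ (2 * S n) - cos (2 * s * t) * cos t ^ (2 * S n)) 0 (PI / 2)).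
  { symmetry. apply (RInt_minus (V := R_CompleteNormedModule)); apply ex_cos_int. }
  assert (E2 : cos_int 0 n - cos_int 0 (S n) = RInt (fun t =>
    cos (2 * 0 * t) * cos t ^ (2 * n) - cos (2 * 0 * t) * cos t ^ (2 * S n)) 0 (PI / 2)).
  { symmetry. apply (RInt_minus (V := R_CompleteNormedModule)); apply ex_cos_int. }
  assert (E3 : 2 * s ^ 2 * (cos_int 0 n - cos_int 0 (S n)) = RInt (fun t => 2 * s ^ 2 *
    (cos (2 * 0 * t) * cos t ^ (2 * n) - cos (2 * 0 * t) * cos t ^ (2 * S n))) 0 (PI / 2)).
  { rewrite E2. symmetry. apply (RInt_scal (V := R_CompleteNormedModule)).
    apply (ex_RInt_minus (V := R_NormedModule)); apply ex_cos_int. }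
  rewrite E3, E1.
  assert (Hpow : forall t, 0 <= cos t ^ (2 * n)).
  { intros t. rewrite pow_mult. apply pow_le, pow2_ge_0. }
  assert (Hpow2 : forall t, cos t ^ (2 * S n) = cos t ^ 2 * cos t ^ (2 * n)).
  { intros t. rewrite <- pow_add. f_equal. lia. }
  split.
  - apply RInt_ge_0; [lra|apply (ex_RInt_minus (V := R_NormedModule)); apply ex_cos_int|].
    intros t Ht.
    rewrite Hcos, <- Rmult_minus_distr_r. rewrite Hpow2.
    apply Rmult_le_pos; [apply one_minus_cos_le|].
    apply Rmult_le_pos; [apply pow2_ge_0|apply Hpow].
  - apply RInt_le; [lra| | |].
    { apply (ex_RInt_minus (V := R_NormedModule)); apply ex_cos_int. }
    { apply (ex_RInt_scal (V := R_NormedModule)).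
      apply (ex_RInt_minus (V := R_NormedModule)); apply ex_cos_int. }
    intros t Ht.
    rewrite !Hcos, Hpow2, !Rmult_1_l.
    assert (H1 := one_minus_cos_le (2 * s * t)).
    assert (H2 := mult_cos_le_sin t ltac:(lra)).
    assert (H3 : 0 <= t * cos t) by (apply Rmult_le_pos; [lra|apply cos_ge_0; lra]).
    assert (H4 : (t * cos t) ^ 2 <= sin t ^ 2) by (apply pow_incr; lra).
    assert (H5 : sin t ^ 2 = 1 - cos t ^ 2).
    { generalize (sin2_cos2 t). unfold Rsqr. intros E. simpl. lra. }
    replace (cos t ^ 2 * cos t ^ (2 * n) - cos (2 * s * t) * (cos t ^ 2 * cos t ^ (2 * n)))
      with ((1 - cos (2 * s * t)) * cos t ^ 2 * cos t ^ (2 * n)) by ring.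
    replace (2 * s ^ 2 * (cos t ^ (2 * n) - cos t ^ 2 * cos t ^ (2 * n))) with
      (2 * s ^ 2 * (1 - cos t ^ 2) * cos t ^ (2 * n)) by ring.
    apply Rmult_le_compat_r; [apply Hpow|].
    apply Rle_trans with ((2 * s * t) ^ 2 / 2 * cos t ^ 2).
    { apply Rmult_le_compat_r; [apply pow2_ge_0|apply H1]. }
    replace ((2 * s * t) ^ 2 / 2 * cos t ^ 2) with (2 * s ^ 2 * (t * cos t) ^ 2) by field.
    rewrite <- H5. apply Rmult_le_compat_l; [generalize (pow2_ge_0 s); lra|exact H4].
Qed.

Lemma cos_int_ratio_lim (s : R) : is_lim_seq (fun n => cos_int s n / cos_int 0 n) 1.
Proof.
  apply is_lim_seq_incr_1.
  apply is_lim_seq_le_le_loc with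
    (u := fun n => 1 - 2 * s ^ 2 / INR n) (w := fun _ => 1).
  - exists 1%nat. intros n Hn.
    assert (Hn0 : 0 < INR n) by (apply lt_0_INR; lia).
    assert (HW := wallis_gt_0 (S n)).
    assert (HB := cos_int_bounds s n). assert (H1 := wallis_succ n).
    assert (Hs := pow2_ge_0 s).
    (* By the Wallis recursion the left side equals [cos_int 0 (S n) / (2n+1)]. *)
    assert (H2 : cos_int 0 n - cos_int 0 (S n) <= cos_int 0 (S n) / INR n).
    { apply (Rmult_le_reg_r (INR n * (2 * INR n + 1)));
        [apply Rmult_lt_0_compat; lra|].
      replace ((cos_int 0 n - cos_int 0 (S n)) * (INR n * (2 * INR n + 1))) with
        (INR n * ((2 * INR n + 1) * cos_int 0 n - (2 * INR n + 1) * cos_int 0 (S n))) by ring.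
      rewrite <- H1.
      replace (cos_int 0 (S n) / INR n * (INR n * (2 * INR n + 1))) with
        ((2 * INR n + 1) * cos_int 0 (S n)) by (field; lra). nra. }
    split; apply (Rmult_le_reg_r (cos_int 0 (S n))); try exact HW.
    + replace (cos_int s (S n) / cos_int 0 (S n) * cos_int 0 (S n)) with (cos_int s (S n))
        by (field; lra).
      replace ((1 - 2 * s ^ 2 / INR n) * cos_int 0 (S n)) with
        (cos_int 0 (S n) - 2 * s ^ 2 * (cos_int 0 (S n) / INR n)) by (field; lra).
      apply (Rmult_le_compat_l (2 * s ^ 2)) in H2; [|lra]. lra.
    + replace (cos_int s (S n) / cos_int 0 (S n) * cos_int 0 (S n)) with (cos_int s (S n))
        by (field; lra). lra.
  - replace (Finite 1) with (Finite (1 - 0)) by (f_equal; ring).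
    apply is_lim_seq_minus'; [apply is_lim_seq_const|apply is_lim_seq_div_INR].
  - apply is_lim_seq_const.
Qed.

Lemma sine_prod_lim (s : R) : is_lim_seq (sine_prod s) (sin (PI * s) / PI).
Proof.
  assert (HPI := PI_RGT_0).
  assert (Hr := cos_int_ratio_lim s).
  replace (sin (PI * s) / PI) with (sin (PI * s) / PI / 1) by (field; lra).
  apply is_lim_seq_ext_loc with
    (fun n => sin (PI * s) / PI / (cos_int s n / cos_int 0 n)).
  (* Since the ratio tends to 1, [cos_int s n] is eventually nonzero and may be divided by. *)
  - assert (Hev : eventually (fun n => / 2 < cos_int s n / cos_int 0 n)).
    { apply (Hr (fun y => / 2 < y)). exists (mkposreal (/ 2) ltac:(lra)).
      intros y Hy. unfold ball in Hy; simpl in Hy;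
        unfold AbsRing_ball, abs, minus, plus, opp in Hy; simpl in Hy.
      apply Rabs_def2 in Hy. lra. }
    destruct Hev as [N HN]. exists N. intros n Hn. specialize (HN n Hn).
    assert (HW := wallis_gt_0 n). assert (H := sine_prod_cos_int s n).
    assert (Hc : cos_int s n <> 0).
    { intros E. rewrite E in HN. unfold Rdiv in HN. lra. }
    replace (sin (PI * s) / PI / (cos_int s n / cos_int 0 n)) with
      (sin (PI * s) * cos_int 0 n / (PI * cos_int s n)) by (field; lra).
    rewrite <- H. field. lra.
  - apply is_lim_seq_div'; [apply is_lim_seq_const|exact Hr|lra].
Qed.

(** * The reflection formula *)

(** The Gauss quotients of [s] and [1 - s] multiply to [sine_prod s n * (1 + (1-s)/n)]; dividing by
    the quotient of [s] leaves known limits. Integer [s] is included: there both sides are 0. *)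
Lemma rgamma_reflection (s : R) : 0 < s ->
  rgamma (1 - s) = sin (PI * s) / PI * Gamma_int s.
Proof.
  intros Hs.
  assert (Hg := gauss_quotient_lim s Hs).
  (* Otherwise the sequence in [Hg] would be constantly 0 and could not tend to 1. *)
  assert (HG : Gamma_int s <> 0).
  { intros E. rewrite E in Hg.
    assert (H0 : is_lim_seq (fun n => gauss_quotient s n * 0) 0).
    { apply is_lim_seq_ext with (fun _ => 0); [intros; ring|apply is_lim_seq_const]. }
    apply is_lim_seq_unique in Hg. apply is_lim_seq_unique in H0.
    rewrite Hg in H0. injection H0. lra. }
  assert (Hpos : forall n, 0 < rising_prod s n).
  { intros n. induction n as [|n IH]; [exact Hs|].
    change (0 < rising_prod s n * (s + INR (S n))).
    apply Rmult_lt_0_compat; [exact IH|]. generalize (pos_INR (S n)). lra. }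
  change (rgamma (1 - s)) with (real (Lim_seq (gauss_quotient (1 - s)))).
  rewrite (is_lim_seq_unique _ (sin (PI * s) / PI * Gamma_int s)); [reflexivity|].
  apply is_lim_seq_ext_loc with
    (fun n => sine_prod s n * (1 + (1 - s) / INR n) * Gamma_int s /
              (gauss_quotient s n * Gamma_int s)).
  - exists 1%nat. intros n Hn.
    assert (Hn0 : 0 < INR n) by (apply lt_0_INR; lia).
    assert (Hf : 0 < INR (fact n)) by apply INR_fact_lt_0.
    assert (Hp : 0 < Rpower (INR n) s) by apply Rpower_gt_0.
    assert (Hr := rising_prod_reflection s n). specialize (Hpos n).
    unfold gauss_quotient.
    replace (Rpower (INR n) (1 - s)) with (INR n / Rpower (INR n) s).
    2:{ unfold Rminus. rewrite Rpower_plus, Rpower_1, Rpower_Ropp by exact Hn0.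
        reflexivity. }
    replace (rising_prod (1 - s) n) with
      (sine_prod s n * INR (fact n) ^ 2 * (INR n + 1 - s) / rising_prod s n)
      by (rewrite <- Hr; field; lra).
    field. repeat split; lra.
  - replace (sin (PI * s) / PI * Gamma_int s) with
      (sin (PI * s) / PI * (1 + 0) * Gamma_int s / 1) by (field; apply PI_neq0).
    apply is_lim_seq_div'; [|exact Hg|lra].
    apply is_lim_seq_mult'; [|apply is_lim_seq_const].
    apply is_lim_seq_mult'; [apply sine_prod_lim|].
    apply is_lim_seq_plus'; [apply is_lim_seq_const|apply is_lim_seq_div_INR].
Qed.

(** * The damped sine and its Taylor expansion *)

(** Imaginary part of [e^(i beta) exp (-u e^(i theta))]. The separate phase [beta] makes the family
    closed under differentiation: each derivative changes the sign and adds [theta] to [beta]. *)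
Definition exp_sin (theta beta u : R) : R :=
  exp (- (u * cos theta)) * sin (beta - u * sin theta).

Lemma is_derive_exp_sin (theta beta u : R) :
  is_derive (exp_sin theta beta) u (- exp_sin theta (beta + theta) u).
Proof.
  unfold exp_sin. auto_derive; [exact I|].
  replace (beta + theta - u * sin theta) with (beta - u * sin theta + theta) by ring.
  rewrite (sin_plus _ theta). unfold Rminus. ring.
Qed.

Lemma Derive_n_exp_sin (theta beta : R) (n : nat) (u : R) :
  Derive_n (exp_sin theta beta) n u = (-1) ^ n * exp_sin theta (beta + INR n * theta) u.
Proof.
  revert u. induction n as [|n IH]; intros u.
  - simpl. rewrite Rmult_0_l, Rplus_0_r. ring.
  - change (Derive (Derive_n (exp_sin theta beta) n) u =
      (-1) ^ S n * exp_sin theta (beta + INR (S n) * theta) u).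
    rewrite (Derive_ext _ _ _ IH). rewrite Derive_scal.
    rewrite (is_derive_unique _ _ _ (is_derive_exp_sin _ _ _)), S_INR.
    replace (beta + (INR n + 1) * theta) with (beta + INR n * theta + theta) by ring.
    simpl. ring.
Qed.

Lemma ex_derive_n_exp_sin (theta beta : R) (n : nat) (u : R) :
  ex_derive_n (exp_sin theta beta) n u.
Proof.
  destruct n as [|n]; [exact I|].
  change (ex_derive (Derive_n (exp_sin theta beta) n) u).
  apply (ex_derive_ext _ _ _ (fun v => eq_sym (Derive_n_exp_sin theta beta n v))).
  apply ex_derive_scal. eexists. apply is_derive_exp_sin.
Qed.

Lemma exp_sin_0 (theta beta : R) : exp_sin theta beta 0 = sin beta.
Proof. unfold exp_sin. rewrite !Rmult_0_l, Ropp_0, exp_0, Rminus_0_r. ring. Qed.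

Lemma exp_sin_abs_le (theta beta u : R) : 0 <= u -> Rabs (exp_sin theta beta u) <= exp u.
Proof.
  intros Hu. unfold exp_sin. rewrite Rabs_mult, (Rabs_pos_eq (exp _)) by (left; apply exp_pos).
  rewrite <- (Rmult_1_r (exp u)).
  apply Rmult_le_compat; [left; apply exp_pos|apply Rabs_pos| |].
  - assert (H : - (u * cos theta) <= u) by (generalize (COS_bound theta); nra).
    destruct H as [H| ->]; [left; now apply exp_increasing|right; reflexivity].
  - apply Rabs_le. apply SIN_bound.
Qed.

Lemma pow_fact_le_exp (u : R) (n : nat) : 0 <= u -> u ^ n / INR (fact n) <= exp u.
Proof.
  intros Hu. apply Rle_trans with (2 := exp_ge_taylor u n Hu).
  assert (Hpos : forall k, 0 <= u ^ k / INR (fact k)).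
  { intros k. apply Rmult_le_pos; [now apply pow_le|].
    left. apply Rinv_0_lt_compat, INR_fact_lt_0. }
  destruct n as [|n]; [right; reflexivity|]. rewrite tech5.
  assert (0 <= sum_f_R0 (fun k => u ^ k / INR (fact k)) n) by (now apply cond_pos_sum). lra.
Qed.

(* Lagrange remainder, with [u^n/n! = (2u)^n/n! / 2^n <= e^(2u) / 2^n]. *)
Lemma exp_sin_taylor (theta beta u : R) (n : nat) : 0 <= u ->
  Rabs (exp_sin theta beta u -
    sum_f_R0 (fun k => u ^ k / INR (fact k) * ((-1) ^ k * sin (beta + INR k * theta))) n)
  <= (/ 2) ^ S n * exp (3 * u).
Proof.
  intros Hu.
  destruct Hu as [Hu| <-].
  - destruct (Taylor_Lagrange (exp_sin theta beta) n 0 u Hu) as [zeta [Hz H]].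
    { intros t _ k _. apply ex_derive_n_exp_sin. }
    rewrite H, Rminus_0_r.
    rewrite (sum_eq _ (fun k => u ^ k / INR (fact k) * ((-1) ^ k * sin (beta + INR k * theta)))).
    2:{ intros k _. now rewrite Derive_n_exp_sin, exp_sin_0. }
    match goal with |- Rabs (?a + ?b - ?a) <= _ => replace (a + b - a) with b by ring end.
    rewrite Derive_n_exp_sin, 2!Rabs_mult, pow_1_abs, Rmult_1_l.
    replace (u ^ S n / INR (fact (S n))) with ((/ 2) ^ S n * ((2 * u) ^ S n / INR (fact (S n)))).
    2:{ rewrite Rpow_mult_distr, pow_inv. field.
        split; [apply INR_fact_neq_0|apply pow_nonzero; lra]. }
    assert (H1 := pow_fact_le_exp (2 * u) (S n) ltac:(lra)).
    assert (H2 := exp_sin_abs_le theta (beta + INR (S n) * theta) zeta ltac:(lra)).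
    assert (H3 : exp zeta <= exp u) by (left; apply exp_increasing; lra).
    replace (3 * u) with (2 * u + u) by ring. rewrite exp_plus.
    rewrite Rabs_pos_eq.
    2:{ apply Rmult_le_pos; [apply pow_le; lra|]. apply Rmult_le_pos; [apply pow_le; lra|].
        left. apply Rinv_0_lt_compat, INR_fact_lt_0. }
    rewrite Rmult_assoc. apply Rmult_le_compat_l; [apply pow_le; lra|].
    apply Rmult_le_compat; [|apply Rabs_pos|exact H1|lra].
    apply Rmult_le_pos; [apply pow_le; lra|]. left. apply Rinv_0_lt_compat, INR_fact_lt_0.
  - rewrite exp_sin_0.
    replace (sum_f_R0 _ n) with (sin beta).
    { rewrite Rminus_diag_eq, Rabs_R0 by reflexivity.
      apply Rmult_le_pos; [apply pow_le; lra|left; apply exp_pos]. }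
    induction n as [|n IH].
    + simpl. rewrite Rmult_0_l, Rplus_0_r. field.
    + rewrite tech5, <- IH. simpl. unfold Rdiv. ring.
Qed.

(** * Exchange of sum and integral *)

Lemma Rpower_le_linear (a A : R) : 0 < a < 1 -> 0 < A ->
  exists C, forall w, 0 < w -> A * Rpower w a <= w / 2 + C.
Proof.
  (* At this [p] the tangent of [A w^a] has slope [a/2], hence less than [1/2]. *)
  intros Ha HA. set (p := Rpower (2 * A) (/ (1 - a))).
  assert (Hp : 0 < p) by apply Rpower_gt_0.
  exists (A * (Rpower p a * (1 - a))). intros w Hw.
  assert (H := Rpower_le_tangent p a w Hp Hw ltac:(lra)).
  assert (Hpa : Rpower p a / p = / (2 * A)).
  { transitivity (Rpower p (a + - (1))).
    { now rewrite Rpower_plus, Rpower_Ropp, Rpower_1. }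
    unfold p. rewrite Rpower_mult.
    replace (/ (1 - a) * (a + - (1))) with (- (1)) by (field; lra).
    now rewrite Rpower_Ropp, Rpower_1 by lra. }
  replace (Rpower p a * a / p * w) with (Rpower p a / p * a * w) in H by (field; lra).
  rewrite Hpa in H. apply (Rmult_le_compat_l A) in H; [|lra].
  replace (A * (Rpower p a * (1 - a) + / (2 * A) * a * w)) with
    (A * (Rpower p a * (1 - a)) + a * w / 2) in H by (field; lra).
  nra.
Qed.

(** In the [k]-th term [w^(a-1) (w^a)^k] is the power in the kernel of [Gamma (a (k+1))], and the
    sign [(-1)^k] merges with [z^k]. *)
Lemma improper_exp_sin_sum (a z theta : R) (n : nat) : 0 < a ->
  improper (fun w => exp (- w) * Rpower w (a - 1) *
      sum_f_R0 (fun k => (z * Rpower w a) ^ k / INR (fact k) *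
                         ((-1) ^ k * sin (theta + INR k * theta))) n)
    (sum_f_R0 (fun k => (- z) ^ k / INR (fact k) *
                        (sin (theta + INR k * theta) * Gamma_int (a * (INR k + 1)))) n).
Proof.
  intros Ha.
  assert (Hk : forall k, improper (fun w => exp (- w) * Rpower w (a - 1) *
      ((z * Rpower w a) ^ k / INR (fact k) * ((-1) ^ k * sin (theta + INR k * theta))))
    ((- z) ^ k / INR (fact k) * (sin (theta + INR k * theta) * Gamma_int (a * (INR k + 1))))).
  { intros k.
    assert (Hs : 0 < a * (INR k + 1)).
    { apply Rmult_lt_0_compat; [exact Ha|generalize (pos_INR k); lra]. }
    rewrite <- Rmult_assoc.
    generalize (improper_scal _ ((- z) ^ k / INR (fact k) * sin (theta + INR k * theta)) _
      (improper_Gamma _ Hs)).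
    apply improper_ext. intros w Hw.
    replace (a * (INR k + 1) - 1) with (a * INR k + (a - 1)) by ring.
    rewrite Rpower_plus, <- Rpower_mult, Rpower_pow by apply Rpower_gt_0.
    replace (- z) with (-1 * z) by ring. rewrite 2!Rpow_mult_distr. unfold Rdiv. ring. }
  induction n as [|n IH].
  - apply Hk.
  - rewrite tech5. generalize (improper_plus _ _ _ _ IH (Hk (S n))).
    apply improper_ext. intros w Hw. rewrite tech5. ring.
Qed.

Lemma improper_exp_sin (a z theta : R) : 0 < a < 1 -> 0 <= z ->
  improper (fun w => exp (- w) * Rpower w (a - 1) * exp_sin theta theta (z * Rpower w a))
    (Series (fun k => (- z) ^ k / INR (fact k) *
                      (sin (theta + INR k * theta) * Gamma_int (a * (INR k + 1))))).
Proof.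
  intros Ha Hz.
  (* The factor [3 z] is that of the Taylor remainder bound; adding 1 keeps the coefficient positive
     when [z = 0]. Half of the decay of [e^-w] survives. *)
  destruct (Rpower_le_linear a (3 * z + 1) Ha ltac:(lra)) as [C HC].
  assert (HC' : forall w, 0 < w -> exp (- w) * Rpower w (a - 1) * exp (3 * (z * Rpower w a))
     <= exp C * (exp (- (/ 2 * w)) * Rpower w (a - 1))).
  { intros w Hw.
    replace (exp C * (exp (- (/ 2 * w)) * Rpower w (a - 1))) with
      (exp C * exp (- (/ 2 * w)) * Rpower w (a - 1)) by ring.
    replace (exp (- w) * Rpower w (a - 1) * exp (3 * (z * Rpower w a))) with
      (exp (- w) * exp (3 * (z * Rpower w a)) * Rpower w (a - 1)) by ring.
    apply Rmult_le_compat_r; [left; apply Rpower_gt_0|].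
    rewrite <- 2!exp_plus.
    assert (H : - w + 3 * (z * Rpower w a) <= C + - (/ 2 * w)).
    { generalize (HC w Hw) (Rpower_gt_0 w a). lra. }
    destruct H as [H| ->]; [left; now apply exp_increasing|right; reflexivity]. }
  assert (Hpos : forall w, 0 < exp (- w) * Rpower w (a - 1)).
  { intros w. apply Rmult_lt_0_compat; [apply exp_pos|apply Rpower_gt_0]. }
  destruct (improper_exists
    (fun w => exp (- w) * Rpower w (a - 1) * exp (3 * (z * Rpower w a))) (exp C) (/ 2) a)
    as [K HK]; [lra|lra|left; apply exp_pos| | |].
  { apply continuous_pos_derivable. intros w Hw. unfold Rpower. auto_derive. lra. }
  { intros w Hw. rewrite Rabs_pos_eq; [now apply HC'|].
    left. apply Rmult_lt_0_compat; [apply Hpos|apply exp_pos]. }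
  destruct (improper_exists
    (fun w => exp (- w) * Rpower w (a - 1) * exp_sin theta theta (z * Rpower w a))
    (exp C) (/ 2) a) as [l Hl]; [lra|lra|left; apply exp_pos| | |].
  { apply continuous_pos_derivable. intros w Hw. unfold exp_sin, Rpower. auto_derive. lra. }
  { intros w Hw. apply Rle_trans with (2 := HC' w Hw).
    rewrite Rabs_mult, (Rabs_pos_eq (exp (- w) * _)) by (left; apply Hpos).
    apply Rmult_le_compat_l; [left; apply Hpos|].
    assert (Hu : 0 <= z * Rpower w a) by (apply Rmult_le_pos; [exact Hz|left; apply Rpower_gt_0]).
    apply Rle_trans with (1 := exp_sin_abs_le theta theta _ Hu).
    destruct Hu as [Hu|Hu]; [left; apply exp_increasing; lra|rewrite <- Hu, Rmult_0_r; lra]. }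
  assert (HS : is_series (fun k => (- z) ^ k / INR (fact k) *
                      (sin (theta + INR k * theta) * Gamma_int (a * (INR k + 1)))) l).
  { change (is_lim_seq (sum_n (fun k => (- z) ^ k / INR (fact k) *
                      (sin (theta + INR k * theta) * Gamma_int (a * (INR k + 1))))) l).
    apply (is_lim_seq_ext (fun n => l - (l - sum_f_R0 (fun k => (- z) ^ k / INR (fact k) *
                      (sin (theta + INR k * theta) * Gamma_int (a * (INR k + 1)))) n))).
    { intros n. rewrite sum_n_Reals. ring. }
    replace (Finite l) with (Finite (l - 0)) by (f_equal; ring).
    apply is_lim_seq_minus'; [apply is_lim_seq_const|].
    apply is_lim_seq_abs_0.
    apply is_lim_seq_le_le with (u := fun _ => 0) (w := fun n => (/ 2) ^ S n * K).
    - intros n. split; [apply Rabs_pos|].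
      (* Integrating the remainder bound shows that the [n]-th partial sum differs from [l] by at
         most [2^-(n+1) K]. *)
      refine (improper_abs_le _ _ _ _ _
        (improper_minus _ _ _ _ Hl (improper_exp_sin_sum a z theta n (proj1 Ha)))
        (improper_scal _ ((/ 2) ^ S n) _ HK)).
      intros w Hw. cbv beta. rewrite <- Rmult_minus_distr_l, Rabs_mult.
      rewrite (Rabs_pos_eq (exp (- w) * _)) by (left; apply Hpos).
      replace ((/ 2) ^ S n * (exp (- w) * Rpower w (a - 1) * exp (3 * (z * Rpower w a)))) with
        (exp (- w) * Rpower w (a - 1) * ((/ 2) ^ S n * exp (3 * (z * Rpower w a)))) by ring.
      apply Rmult_le_compat_l; [left; apply Hpos|].
      apply exp_sin_taylor. apply Rmult_le_pos; [exact Hz|left; apply Rpower_gt_0].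
    - apply is_lim_seq_const.
    - replace (Finite 0) with (Finite (0 * K)) by (f_equal; ring).
      apply is_lim_seq_mult'; [|apply is_lim_seq_const].
      apply (is_lim_seq_incr_1 (fun n => (/ 2) ^ n)).
      apply is_lim_seq_geom. rewrite Rabs_pos_eq; lra. }
  now rewrite (is_series_unique _ _ HS).
Qed.

(** * Change of variable and the two integral representations *)

(** Substitution on compact intervals; as [psi] carries each end filter to itself, the images
    [psi a] and [psi b] are eventually admissible end points for [g]. *)
Lemma improper_comp (g psi dpsi : R -> R) (l : R) :
  continuous_pos g -> improper g l ->
  (forall y, 0 < y -> 0 < psi y) ->
  (forall y, 0 < y -> is_derive psi y (dpsi y)) -> continuous_pos dpsi ->
  filterlim psi (at_right 0) (at_right 0) ->
  filterlim psi (Rbar_locally p_infty) (Rbar_locally p_infty) ->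
  improper (fun y => dpsi y * g (psi y)) l.
Proof.
  intros Hg Hl Hpos Hd Hdc H0 Hinf P HP.
  destruct (Hl P HP) as [Q R HQ HR H].
  assert (H1 : at_right 0 (fun a => 0 < a)).
  { exists (mkposreal 1 Rlt_0_1). intros y _ Hy. exact Hy. }
  assert (H2 : Rbar_locally p_infty (fun b => 0 < b)) by (exists 0; tauto).
  apply (Filter_prod _ _ _ (fun a => Q (psi a) /\ 0 < a) (fun b => R (psi b) /\ 0 < b)).
  - apply filter_and; [exact (H0 Q HQ)|exact H1].
  - apply filter_and; [exact (Hinf R HR)|exact H2].
  - intros a b [Ha Ha0] [Hb Hb0]. destruct (H (psi a) (psi b) Ha Hb) as [v [Hv HPv]].
    exists v. split; [|exact HPv]. simpl in *.
    rewrite <- (is_RInt_unique (V := R_CompleteNormedModule) _ _ _ _ Hv).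
    assert (Hx : forall x, Rmin a b <= x -> 0 < x).
    { intros x Hx. apply Rlt_le_trans with (2 := Hx). now apply Rmin_glb_lt. }
    apply (is_RInt_comp (V := R_CompleteNormedModule) g psi dpsi).
    + intros x [Hx1 _]. apply Hg, Hpos, Hx, Hx1.
    + intros x [Hx1 _]. split; [apply Hd|apply Hdc]; apply Hx, Hx1.
Qed.

Lemma Series_u_nu (a z : R) : 0 < a ->
  PI * Series (fun k => (- z) ^ k / INR (fact k) * rgamma (1 - a * (INR k + 1))) =
  Series (fun k => (- z) ^ k / INR (fact k) *
    (sin (a * PI + INR k * (a * PI)) * Gamma_int (a * (INR k + 1)))).
Proof.
  intros Ha. rewrite <- Series_scal_l. apply Series_ext. intros k.
  assert (Hs : 0 < a * (INR k + 1)).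
  { apply Rmult_lt_0_compat; [exact Ha|generalize (pos_INR k); lra]. }
  rewrite rgamma_reflection by exact Hs.
  replace (a * PI + INR k * (a * PI)) with (PI * (a * (INR k + 1))) by ring.
  assert (Hf := INR_fact_neq_0 k). field. split; [exact Hf|exact PI_neq0].
Qed.

Lemma scaled_power_at_right_0 (la p t : R) : 0 < la -> 0 < p -> 0 < t ->
  filterlim (fun y => Rpower (la * y) p * t) (at_right 0) (at_right 0).
Proof.
  intros Hla Hp Ht P [d Hd].
  (* Solution of [(la e)^p t = d]. *)
  set (e := Rpower (d / t) (/ p) / la).
  assert (Hdt : 0 < d / t) by (apply Rdiv_lt_0_compat; [apply cond_pos|exact Ht]).
  assert (He : 0 < e) by (apply Rdiv_lt_0_compat; [apply Rpower_gt_0|exact Hla]).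
  exists (mkposreal e He). intros y Hy Hy0. apply Hd.
  2:{ apply Rmult_lt_0_compat; [apply Rpower_gt_0|exact Ht]. }
  unfold ball in *; simpl in *; unfold AbsRing_ball, abs, minus, plus, opp in *;
    simpl in *.
  apply Rabs_def2 in Hy. rewrite Ropp_0, Rplus_0_r in *.
  rewrite Rabs_pos_eq.
  2:{ apply Rmult_le_pos; left; [apply Rpower_gt_0|exact Ht]. }
  replace (pos d) with (Rpower (la * e) p * t).
  - apply Rmult_lt_compat_r; [exact Ht|]. apply Rlt_Rpower_l; [exact Hp|].
    split; [now apply Rmult_lt_0_compat|]. apply Rmult_lt_compat_l; [exact Hla|lra].
  - unfold e. replace (la * (Rpower (d / t) (/ p) / la)) with (Rpower (d / t) (/ p))
      by (field; lra).
    rewrite Rpower_mult, Rinv_l, Rpower_1 by (lra || exact Hdt). field. lra.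
Qed.

Lemma scaled_power_at_infty (la p t : R) : 0 < la -> 0 < p -> 0 < t ->
  filterlim (fun y => Rpower (la * y) p * t) (Rbar_locally p_infty) (Rbar_locally p_infty).
Proof.
  intros Hla Hp Ht P [M HM].
  (* The maximum with 1 makes [B] positive, so that its root [B^(1/p)] inverts the power. *)
  set (B := Rmax M 1 / t).
  assert (HB : 0 < B).
  { apply Rdiv_lt_0_compat; [|exact Ht]. generalize (Rmax_r M 1). lra. }
  exists (Rpower B (/ p) / la). intros y Hy. apply HM.
  apply Rle_lt_trans with (1 := Rmax_l M 1).
  replace (Rmax M 1) with (Rpower (Rpower B (/ p)) p * t).
  - apply Rmult_lt_compat_r; [exact Ht|]. apply Rlt_Rpower_l; [exact Hp|].
    split; [apply Rpower_gt_0|].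
    apply (Rmult_lt_compat_l la) in Hy; [|exact Hla].
    replace (la * (Rpower B (/ p) / la)) with (Rpower B (/ p)) in Hy by (field; lra).
    exact Hy.
  - rewrite Rpower_mult, Rinv_l, Rpower_1 by (lra || exact HB). unfold B. field. lra.
Qed.

Theorem theorem5p3 (lambda nu : R) (Hl : 0 < lambda) (Hnu0 : 0 < nu) (Hnu2 : nu < 2)
  (x t : R) (Ht : 0 < t) :
  is_RInt_gen
    (fun w : R =>
       / (2 * PI * lambda * Rpower t (nu / 2)) *
       (exp (- w) * Rpower w (nu / 2 - 1) *
        exp (- (Rabs x * Rpower w (nu / 2) / (lambda * Rpower t (nu / 2)))
               * cos (nu * PI / 2)) *
        sin (nu * PI / 2
             - Rabs x * Rpower w (nu / 2) / (lambda * Rpower t (nu / 2))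
               * sin (nu * PI / 2))))
    (at_right 0) (Rbar_locally p_infty) (u_nu lambda nu x t)
  /\
  is_RInt_gen
    (fun y : R =>
       / (nu * PI) *
       (exp (- (Rabs x * y * cos (nu * PI / 2)) - Rpower (lambda * y) (2 / nu) * t) *
        sin (nu * PI / 2 - Rabs x * y * sin (nu * PI / 2))))
    (at_right 0) (Rbar_locally p_infty) (u_nu lambda nu x t).
Proof.
  assert (HPI := PI_RGT_0).
  set (a := nu / 2). assert (Ha : 0 < a < 1) by (unfold a; lra).
  assert (HT : 0 < Rpower t a) by apply Rpower_gt_0.
  set (z := Rabs x / (lambda * Rpower t a)).
  assert (Hz : 0 <= z).
  { apply Rmult_le_pos; [apply Rabs_pos|]. left. apply Rinv_0_lt_compat.
    now apply Rmult_lt_0_compat. }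
  (* The argument of [rgamma] in [u_nu] is [1 - a (k+1)], so reflection applies at [s = a (k+1)] and
     brings the factor [1/PI]. *)
  assert (Hu : u_nu lambda nu x t = / (2 * PI * lambda * Rpower t a) *
    Series (fun k => (- z) ^ k / INR (fact k) *
      (sin (a * PI + INR k * (a * PI)) * Gamma_int (a * (INR k + 1))))).
  { rewrite <- Series_u_nu by apply Ha. unfold u_nu. fold a.
    rewrite (Series_ext _ (fun k => (- z) ^ k / INR (fact k) * rgamma (1 - a * (INR k + 1)))).
    - field. repeat split; lra.
    - intros k. replace (- Rabs x / (lambda * Rpower t a)) with (- z)
        by (unfold z; field; lra).
      do 2 f_equal. unfold a. field. }
  assert (H1 : improper
    (fun w : R =>
       / (2 * PI * lambda * Rpower t (nu / 2)) *
       (exp (- w) * Rpower w (nu / 2 - 1) *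
        exp (- (Rabs x * Rpower w (nu / 2) / (lambda * Rpower t (nu / 2)))
               * cos (nu * PI / 2)) *
        sin (nu * PI / 2
             - Rabs x * Rpower w (nu / 2) / (lambda * Rpower t (nu / 2))
               * sin (nu * PI / 2)))) (u_nu lambda nu x t)).
  { rewrite Hu.
    generalize (improper_scal _ (/ (2 * PI * lambda * Rpower t a)) _
      (improper_exp_sin a z (a * PI) Ha Hz)).
    apply improper_ext. intros w Hw. unfold exp_sin. fold a.
    replace (nu * PI / 2) with (a * PI) by (unfold a; field).
    replace (Rabs x * Rpower w a / (lambda * Rpower t a)) with (z * Rpower w a)
      by (unfold z; field; lra).
    rewrite Ropp_mult_distr_l. ring. }
  split; [exact H1|].
  assert (Hp : 0 < 2 / nu) by (apply Rdiv_lt_0_compat; lra).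
  refine (improper_ext _ _ _ _ (improper_comp _ (fun y => Rpower (lambda * y) (2 / nu) * t)
    (fun y => lambda * (2 / nu) * Rpower (lambda * y) (2 / nu - 1) * t) _ _ H1 _ _ _ _ _)).
  - intros y Hy. cbv beta.
    assert (Hly : 0 < lambda * y) by now apply Rmult_lt_0_compat.
    fold a. set (v := Rpower (lambda * y) (2 / nu) * t).
    assert (Hv : 0 < v) by (apply Rmult_lt_0_compat; [apply Rpower_gt_0|exact Ht]).
    (* The exponents [2/nu] and [a = nu/2] cancel, so [|x| v^a / (lambda t^a)] becomes [|x| y]. *)
    assert (Hva : Rpower v a = lambda * y * Rpower t a).
    { unfold v. rewrite <- Rpower_mult_distr, Rpower_mult by (try apply Rpower_gt_0; exact Ht).
      replace (2 / nu * a) with 1 by (unfold a; field; lra). now rewrite Rpower_1. }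
    replace (Rpower v (a - 1)) with (lambda * y * Rpower t a / v).
    2:{ rewrite <- Hva. unfold Rminus. now rewrite Rpower_plus, Rpower_Ropp, Rpower_1. }
    rewrite Hva.
    replace (Rabs x * (lambda * y * Rpower t a) / (lambda * Rpower t a)) with (Rabs x * y)
      by (field; lra).
    replace (- (Rabs x * y * cos (nu * PI / 2)) - v) with
      (- v + - (Rabs x * y) * cos (nu * PI / 2)) by ring.
    rewrite exp_plus.
    (* The Jacobian becomes [(2/nu) v / y]; times [v^(a-1) = lambda y t^a / v] and the prefactor
       [1 / (2 PI lambda t^a)] it gives [1 / (nu PI)]. *)
    replace (Rpower (lambda * y) (2 / nu - 1)) with (v / t / (lambda * y)).
    2:{ unfold v, Rminus. rewrite Rpower_plus, Rpower_Ropp, Rpower_1 by exact Hly.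
        field. lra. }
    field. repeat split; lra.
  - apply continuous_pos_derivable. intros w Hw. unfold Rpower. auto_derive. lra.
  - intros y Hy. apply Rmult_lt_0_compat; [apply Rpower_gt_0|exact Ht].
  - intros y Hy. assert (Hly : 0 < lambda * y) by now apply Rmult_lt_0_compat.
    evar_last.
    + apply (is_derive_ext (fun y => t * Rpower (lambda * y) (2 / nu)));
        [intros; apply Rmult_comm|].
      apply (is_derive_scal (fun y => Rpower (lambda * y) (2 / nu))).
      apply (is_derive_comp (fun v => Rpower v (2 / nu)) (fun y => lambda * y)).
      * now apply is_derive_Rpower.
      * auto_derive; [exact I|reflexivity].
    + unfold scal; simpl; unfold mult; simpl. ring.
  - apply continuous_pos_derivable. intros w Hw. unfold Rpower. auto_derive.
    now apply Rmult_lt_0_compat.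
  - now apply scaled_power_at_right_0.
  - now apply scaled_power_at_infty.
Qed.
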